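(* Let $A$ be a commutative ring, $f:\mathbb{Z}_{>0}\times\mathbb{Z}_{>0}\to A$ a map, and $M\in\mathbb{Z}_{>0}$. Let $\lambda/\mu$ be an edge-connected skew diagram with an outside decomposition $\Theta=(\theta_1,\dots,\theta_n)$, and let ${\bf k}\in T^{\mathrm{diag}}(\lambda/\mu)$. Then \[ S^M_f({\bf k})=\det\big(S^M_f(R^{\bf k}_\Theta(i,j))\big)_{1\le i,j\le n}, \] where $S^M_f(R^{\bf k}_\Theta(i,j))$ is set to $0$ whenever $R_\Theta(i,j)$ is undefined, and $S^M_f(\emptyset)=1$.
   Context: A partition is $\lambda=(\lambda_1\ge\dots\ge\lambda_h\ge1)$; for partitions $\mu=(\mu_1,\dots,\mu_r)\subset\lambda$ (i.e. $r\le h$, $\mu_j\le\lambda_j$) the skew diagram is $D(\lambda/\mu)=\{(i,j)\in\mathbb{Z}^2: 1\le i\le h,\ \mu_i<j\le\lambda_i\}$ (with $\mu_i=0$ for $i>r$); row index $i$ increases downward. It is edge-connected if its boxes are connected through shared edges. A Young tableau ${\bf k}=(k_{i,j})$ of shape $\lambda/\mu$ assigns $k_{i,j}\in\mathbb{Z}_{\ge1}$ to each box. It is semi-standard if $m_{i,j}<m_{i+1,j}$ and $m_{i,j}\le m_{i,j+1}$ whenever both boxes lie in the diagram; $\mathrm{SSYT}_M(\lambda/\mu)$ is the set of semi-standard tableaux with all entries in $\{1,\dots,M-1\}$. Define $S^M_f({\bf k})=\sum_{(m_{i,j})\in\mathrm{SSYT}_M(\lambda/\mu)}\prod_{(i,j)\in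 D(\lambda/\mu)} f(m_{i,j},k_{i,j})$ and $S^M_f(\emptyset)=1$ (this depends only on the shape up to translation). The content of a diagram $D$ is $c(D)=\{j-i:(i,j)\in D\}$. A ribbon is an (edge-connected) skew diagram containing no $2\times2$ square; it has exactly one box of each content in an interval of integers, its starting box being the one of minimal content and its ending box the one of maximal content. An outside decomposition of $\lambda/\mu$ is a tuple $\Theta=(\theta_1,\dots,\theta_n)$ of ribbons whose disjoint union is $D(\lambda/\mu)$, such that each starting box $(s,t)$ lies on the left or bottom perimeter (i.e. $(s,t-1)\notin D(\lambda/\mu)$ or $(s+1,t)\notin D(\lambda/\mu)$) and each ending box $(u,v)$ lies on the right or top perimeter (i.e. $(u,v+1)\notin D(\lambda/\mu)$ or $(u-1,v)\notin D(\lambda/\mu)$). For such $\Theta$ of an edge-connected $\lambda/\mu$ there is a ribbon $R_\Theta$, unique up to translation by vectors $(t,t)$, with $c(R_\Theta)=c(\lambda/\mu)$ and containing a diagonal translate $\{(i+t,j+t)\}$ of each $\theta_i$. For $1\le i,j\le n$: if $\min c(\theta_i)\le\max c(\theta_j)$, $R_\Theta(i,j)$ is the subribbon of $R_\Theta$ consisting of its boxes with content in $[\min c(\theta_i),\max c(\theta_j)]$; if $\min c(\theta_i)=\max c(\theta_j)+1$, $R_\Theta(i,j)=\emptyset$; if $\min c(\theta_i)>\max c(\theta_j)+1$, $R_\Theta(i,j)$ is undefined. $T^{\mathrm{diag}}(\lambda/\mu)$ is the set of tableaux ${\bf k}$ of shape $\lambda/\mu$ with $k_{i,j}=k_{i',j'}$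 whenever $j-i=j'-i'$. For such ${\bf k}$, $R^{\bf k}_\Theta(i,j)$ is the tableau of shape $R_\Theta(i,j)$ whose entry at a box of content $c$ is the common value of ${\bf k}$ on the boxes of $\lambda/\mu$ of content $c$.
   Formalization: The stated conditions do not determine R_Θ (for λ=(2) cut into two boxes both dominoes qualify and one fails), so R_Θ is also required to continue up (right) after a ribbon's ending box on the top (right) perimeter, unless its content is maximal. *)

(* Defs.v *)
From mathcomp Require Import all_boot all_order all_algebra.
From mathcomp Require Import finmap.

Set Implicit Arguments.
Unset Strict Implicit.
Unset Printing Implicit Defensive.

Import Order.TTheory GRing.Theory Num.Theory.

Local Open Scope fset_scope.
Local Open Scope ring_scope.

Notation box := (int * int)%type.

(* Matrix coordinates: the row index increases downward. *)
Definition box_up (x : box) : box := (x.1 - 1, x.2).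
Definition box_down (x : box) : box := (x.1 + 1, x.2).
Definition box_left (x : box) : box := (x.1, x.2 - 1).
Definition box_right (x : box) : box := (x.1, x.2 + 1).
Definition dshift (t : int) (x : box) : box := (x.1 + t, x.2 + t).
Definition content (x : box) : int := x.2 - x.1.

Definition is_partition (lam : seq nat) : bool :=
  sorted geq lam && all (leq 1) lam.

Definition subpartition (mu lam : seq nat) : Prop :=
  (size mu <= size lam)%N /\
  forall i, (i < size mu)%N -> (nth 0 mu i <= nth 0 lam i)%N.

(* [nth] is 0-based, so the part lambda_(i+1) is [nth 0 lam i]. *)
Definition skew_diagram (lam mu : seq nat) : {fset box} :=
  [fset x : box in [seq ((i.+1)%:Z, j%:Z) | i <- iota 0 (size lam),
     j <- index_iota (nth 0 mu i).+1 (nth 0 lam i).+1]].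

Lemma in_skew_diagram lam mu (i j : nat) :
  (((i.+1)%:Z, j%:Z) \in skew_diagram lam mu)
  = (i < size lam)%N && (nth 0 mu i < j <= nth 0 lam i)%N.
Proof.
rewrite !inE; apply/allpairsPdep/andP => [[a [b []]]|[ltil ltj]].
  by rewrite mem_iota mem_index_iota ltnS => ltal ltb [-> ->].
by exists i, j; rewrite mem_iota mem_index_iota ltnS.
Qed.

Definition is_skew_diagram (D : {fset box}) : Prop :=
  exists lam mu, [/\ is_partition lam, is_partition mu,
                     subpartition mu lam & D = skew_diagram lam mu].

Definition edge_adjacent (x y : box) : bool :=
  [|| y == box_up x, y == box_down x, y == box_left x | y == box_right x].

Definition edge_connected (D : {fset box}) : Prop :=
  forall x y : D, connect [rel u v : D | edge_adjacent (val u) (val v)] x y.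

Definition contents (D : {fset box}) : {fset int} := [fset content x | x in D].

(* Minimal and maximal element of c(D), for nonempty D. *)
Definition min_content (D : {fset box}) : int :=
  head 0 (sort <=%R (contents D)).
Definition max_content (D : {fset box}) : int :=
  last 0 (sort <=%R (contents D)).

(* A translate of a ribbon by (t,t) with t large lies in the positive quadrant,
   where it is literally a skew diagram; so no translation is needed here. *)
Definition is_ribbon (R : {fset box}) : Prop :=
  [/\ is_skew_diagram R, edge_connected R
    & forall x, ~~ [&& x \in R, box_right x \in R, box_down x \in R
                     & box_down (box_right x) \in R]].

Definition starting_box (R : {fset box}) (x : box) : Prop :=
  x \in R /\ content x = min_content R.
Definition ending_box (R : {fset box}) (x : box) : Prop :=
  x \in R /\ content x = max_content R.

Definition outside_decomposition (D : {fset box}) (n : nat)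
    (Theta : 'I_n -> {fset box}) : Prop :=
  [/\ (forall i, is_ribbon (Theta i) /\ Theta i != fset0),
      D = \bigcup_(i <- enum 'I_n) Theta i,
      (forall i j, i != j -> [disjoint Theta i & Theta j]),
      (forall i x, starting_box (Theta i) x ->
         (box_left x \notin D) || (box_down x \notin D))
    & (forall i x, ending_box (Theta i) x ->
         (box_right x \notin D) || (box_up x \notin D))].

(* The Hamel-Goulden cutting strip R_Theta.  The first three clauses alone do
   not determine it: between two consecutive contents that no ribbon joins
   they leave the direction of R free.  The last clause is the
   usual convention settling it: a ribbon ending on the top (resp. right)
   perimeter is continued upwards (resp. to the right), unless it already
   reaches the maximal content of D. *)
Definition is_cutting_strip (D : {fset box}) (n : nat)
    (Theta : 'I_n -> {fset box}) (R : {fset box}) : Prop :=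
  [/\ is_ribbon R,
      contents R = contents D,
      (forall i, exists t : int,
         forall x, x \in Theta i -> dshift t x \in R)
    & (forall i x r, ending_box (Theta i) x -> content x != max_content D ->
         r \in R -> content r = content x ->
         (box_up x \notin D -> box_up r \in R) /\
         (box_right x \notin D -> box_right r \in R))].

Definition young_tableau (D : {fset box}) (k : {ffun D -> nat}) : Prop :=
  forall x, (0 < k x)%N.

Definition diag_constant (D : {fset box}) (k : {ffun D -> nat}) : Prop :=
  forall x y : D, content (val x) = content (val y) -> k x = k y.

Definition semistandard (D : {fset box}) (M : nat)
    (m : {ffun D -> 'I_M}) : bool :=
  [&& [forall x, (0 < m x)%N],
      [forall x, forall y, (val y == box_down (val x)) ==> (m x < m y)%N]
    & [forall x, forall y, (val y == box_right (val x)) ==> (m x <= m y)%N]].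

(* The values of [f] and [k] at 0 never matter: the entries of [m] are positive
   and those of [k] are assumed to be. *)
Definition schur_sum (A : comPzRingType) (f : nat -> nat -> A) (M : nat)
    (D : {fset box}) (k : {ffun D -> nat}) : A :=
  \sum_(m : {ffun D -> 'I_M} | semistandard m) \prod_(x : D) f (m x) (k x).

Lemma schur_sum_fset0 (A : comPzRingType) (f : nat -> nat -> A) (M : nat)
    (k : {ffun (fset0 : {fset box}) -> nat}) : schur_sum f M k = 1.
Proof.
have no (x : (fset0 : {fset box})) : False.
  by have := valP x; rewrite /= in_fset0.
pose e0 : {ffun (fset0 : {fset box}) -> 'I_M} :=
  [ffun x => False_rect _ (no x)].
rewrite /schur_sum (bigD1 e0) /=; last first.
  by apply/and3P; split; apply/forallP => x; elim: (no x).
rewrite [X in X + _]big1 => [|x]; last by elim: (no x).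
rewrite big1 ?addr0 // => m /andP[_ /eqP[]].
by apply/ffunP => x; elim: (no x).
Qed.

(* The common value of [k] on the boxes of content [c]; 0 if there are none. *)
Definition diag_value (D : {fset box}) (k : {ffun D -> nat}) (c : int) : nat :=
  if [pick x : D | content (val x) == c] is Some x then k x else 0%N.

Definition subribbon (R : {fset box}) (a b : int) : {fset box} :=
  [fset x in R | a <= content x <= b].

Definition diag_tableau (D : {fset box}) (k : {ffun D -> nat})
    (R : {fset box}) : {ffun R -> nat} :=
  [ffun x : R => diag_value k (content (val x))].

(* When min c(theta_i) = max c(theta_j) + 1 the subribbon is empty and the sum
   is 1 by [schur_sum_fset0]. *)
Definition strip_entry (A : comPzRingType) (f : nat -> nat -> A) (M : nat)
    (D : {fset box}) (k : {ffun D -> nat}) (n : nat)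
    (Theta : 'I_n -> {fset box}) (R : {fset box}) (i j : 'I_n) : A :=
  let a := min_content (Theta i) in
  let b := max_content (Theta j) in
  if a <= b + 1 then schur_sum f M (diag_tableau k (subribbon R a b)) else 0.

(* Main.v *)
Require Import Defs.
From mathcomp Require Import all_boot all_order all_algebra.
From mathcomp Require Import fingroup perm finmap zify.

(* The tableau is scanned content by content. The cutting strip turns each step from
   content c to c + 1 into a move right or up, and the ribbons of the decomposition are
   exactly the maximal chains of D along these moves. Let B_c be the n x n matrix whose
   (i,j) entry is the strip sum from the start of theta_i to the end of theta_j if
   theta_j ends before c, the strip sum from the start of theta_i to content c with
   prescribed last entry (that of theta_j) if theta_j is alive at c, and the Kronecker
   delta if theta_j starts after c. Then det B_c is the sum over the semistandard
   fillings of the boxes of content at most c with prescribed entries at content c.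
   Indeed, once the entries of content c + 1 are fixed, those of content c range over
   disjoint intervals, so multilinearity sums each column of B_c separately, into a
   difference of two columns of B_{c+1} up to weights; unitriangular column and row
   operations finish the step. No sign bookkeeping is needed as columns follow ribbons.
   The same identity for n = 1 shows that the entries of the last matrix are the strip
   sums S(R(i,j)). *)

Set Implicit Arguments.
Unset Strict Implicit.
Unset Printing Implicit Defensive.

Import Order.TTheory GRing.Theory Num.Theory.

Local Open Scope fset_scope.
Local Open Scope ring_scope.

(** * Determinants: triangularity and column expansion *)

(** If all [X i (s i)] are nonzero, then [rk i <= rk (s i)], strictly where [s] moves [i]. As [s]
    preserves the sum of the ranks, it is the identity. Ties in [rk] are allowed. *)
Lemma det_unitriangular (A : comPzRingType) n (rk : 'I_n -> int) (X : 'M[A]_n) :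
  (forall i, X i i = 1) ->
  (forall i j, i != j -> X i j != 0 -> rk i < rk j) -> \det X = 1.
Proof.
move=> X1 Xlt; rewrite /determinant (bigD1 (1%g : {perm 'I_n})) //= odd_perm1 expr0 mul1r.
rewrite [X in X + _]big1 => [|i _]; last by rewrite perm1.
rewrite big1 ?addr0 // => s s1.
case: (pickP (fun i => (X i (s i) == 0))) => [i /eqP Xi|nz].
  by rewrite (bigD1 i) //= Xi mul0r mulr0.
have mono i : rk i <= rk (s i).
  have [-> //|si] := eqVneq (s i) i.
  by apply/ltW/Xlt; rewrite ?nz // eq_sym.
case/eqP: s1; apply/permP => i; rewrite perm1.
have [//|si] := eqVneq (s i) i.
suff: \sum_j rk j < \sum_j rk (s j).
  by rewrite [X in _ < X](reindex_inj (@perm_inj _ s^-1%g))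
     [X in _ < X](eq_bigr rk) ?ltxx // => j _; rewrite permKV.
rewrite (bigD1 i) //= [X in _ < X](bigD1 i) //=.
by rewrite ltr_leD ?ler_sum ?Xlt ?nz // eq_sym.
Qed.

(** Multilinearity in the columns; after transposition the Leibniz products run over the columns and
    distribute over the sums. *)
Lemma det_col_sum (A : comPzRingType) n (S : finType) (Q : 'I_n -> pred S)
    (F : 'I_n -> 'I_n -> S -> A) :
  \det (\matrix_(i, j) \sum_(s | Q j s) F i j s)
  = \sum_(g in family Q) \det (\matrix_(i, j) F i j (g j)).
Proof.
rewrite -det_tr /determinant [RHS](eq_bigr _ (fun g _ => esym (det_tr _))).
rewrite exchange_big /=; apply: eq_bigr => s _.
rewrite -big_distrr /=; congr (_ * _).
under eq_bigr do rewrite !mxE.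
rewrite bigA_distr_big_dep; apply: eq_bigr => g _.
by apply: eq_bigr => j _; rewrite !mxE.
Qed.

(** * Order-convex sets of boxes and steps between adjacent contents *)

(** The geometric input of the transfer argument. Skew diagrams have this property, and so do
    subribbons, with no normalization of coordinates. *)
Definition order_convex (D : {fset box}) : Prop :=
  forall x y z, x \in D -> y \in D ->
    x.1 <= z.1 <= y.1 -> x.2 <= z.2 <= y.2 -> z \in D.

Definition fw (d : bool) (x : box) : box := if d then box_right x else box_up x.

(* [s <= t] for a step to the right, [t < s] for a step up. *)
Definition fw_rel (d : bool) (s t : nat) : bool := (s <= t)%N == d.

Lemma content_fw d x : content (fw d x) = content x + 1.
Proof. by rewrite /content; case: d => /=; lia. Qed.

(** The two kinds of step impose complementary relations; this is what turns a pair of constraints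
    into a difference of two sums. *)
Lemma fw_relN d s t : fw_rel (~~ d) s t = ~~ fw_rel d s t.
Proof. by rewrite /fw_rel; case: d; case: leq. Qed.

(** Boxes on adjacent diagonals are comparable. If [x <= y], the interval contains the boxes right
    of [x] and left of [y]; if [y <= x], those above [x] and below [y]. One of the two always
    settles the claim. *)
Lemma order_convex_step D d x y : order_convex D -> x \in D -> y \in D ->
  content y = content x + 1 ->
  fw (~~ d) x \in D \/ exists2 z, z \in D & y = fw d z.
Proof.
case: x y => [x1 x2] [y1 y2] cvx xD yD; rewrite /content /= => cxy.
have [y1E|n1] := eqVneq y1 x1.
  have yE : (y1, y2) = fw true (x1, x2) by congr (_, _) => /=; lia.
  by case: d; [right; exists (x1, x2) | left; rewrite -yE].
have [y1E|n2] := eqVneq y1 (x1 - 1).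
  have yE : (y1, y2) = fw false (x1, x2) by congr (_, _) => /=; lia.
  by case: d; [left; rewrite -yE | right; exists (x1, x2)].
have [le|lt] := leP x1 y1; case: d.
- right; exists (y1, y2 - 1); last by congr (_, _) => /=; lia.
  by apply: (cvx _ _ _ xD yD) => /=; lia.
- by left; apply: (cvx _ _ _ xD yD) => /=; lia.
- by left; apply: (cvx _ _ _ yD xD) => /=; lia.
- right; exists (y1 + 1, y2); last by congr (_, _) => /=; lia.
  by apply: (cvx _ _ _ yD xD) => /=; lia.
Qed.

(** Two boxes on one diagonal are strictly comparable: the interval contains the box left of the
    larger and the box below the smaller. Hence at most one ribbon can start at each content. *)
Lemma order_convex_source D d x y : order_convex D -> x \in D -> y \in D ->
  content y = content x -> x != y ->
  exists2 z, z \in D & x = fw d z \/ y = fw d z.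
Proof.
case: x y => [x1 x2] [y1 y2] cvx xD yD; rewrite /content /= => cxy xy.
have x1y1 : x1 != y1.
  by apply: contra xy => /eqP x1E; apply/eqP; congr (_, _) => //; lia.
have [lt|lt|E] := ltgtP x1 y1; last by rewrite E eqxx in x1y1.
  case: d; [exists (y1, y2 - 1) | exists (x1 + 1, x2)];
    rewrite ?(cvx _ _ _ xD yD) //=; try lia;
    by [right; congr (_, _) => /=; lia | left; congr (_, _) => /=; lia].
case: d; [exists (x1, x2 - 1) | exists (y1 + 1, y2)];
    rewrite ?(cvx _ _ _ yD xD) //=; try lia;
    by [right; congr (_, _) => /=; lia | left; congr (_, _) => /=; lia].
Qed.

Lemma order_convex_corner D x : order_convex D ->
  fw true x \in D -> fw false x \in D -> fw true (fw false x) \in D.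
Proof. by move=> cvx rD uD; apply: (cvx _ _ _ uD rD) => /=; lia. Qed.

(** * Transfer of the determinant from one content to the next *)

Section Transfer.
Variables (A : comPzRingType) (M : nat) (w : nat -> 'I_M.+1 -> A).
Variable dir : nat -> bool.

(* The weighted sum over the fillings of the strip from level [a] to level [t] with
   last entry [s]. *)
Fixpoint amp (a t : nat) (s : 'I_M.+1) : A :=
  if t is t'.+1 then
    w t s * ((a == t)%:R
             + \sum_(s' : 'I_M.+1 | (0 < s')%N && fw_rel (dir t') s' s) amp a t' s')
  else 0.

Lemma amp_eq0 a t s : (t < a)%N -> amp a t s = 0.
Proof.
elim: t s => [//|t IHt] s /= ta.
rewrite (gtn_eqF ta) add0r big1 ?mulr0 // => s' _.
by apply: IHt; apply: ltnW.
Qed.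

(** The total weight of the strip from level [a] to level [b]; the first summand is the empty strip,
    of weight 1. *)
Definition green (a b : nat) : A :=
  (a == b.+1)%:R + \sum_(s : 'I_M.+1 | (0 < s)%N) amp a b s.

Lemma green_eq0 a b : (b.+1 < a)%N -> green a b = 0.
Proof.
move=> ba; rewrite /green (gtn_eqF ba) add0r big1 // => s _.
by rewrite amp_eq0 // ltnW.
Qed.

Variables (c0 : int) (D : {fset box}).

(** With [c0] below every content, levels are positive, and level 0, where no box lies, is the base
    of the scan. *)
Definition level (x : box) : nat := `|content x - c0|%N.

Definition entry (m : {ffun D -> 'I_M.+1}) (x : box) : 'I_M.+1 :=
  if insub x is Some y then m y else ord0.

Lemma entry_val m (x : D) : entry m (val x) = m x.
Proof. by rewrite /entry valK. Qed.

(* Semistandard on the boxes of level at least [t], with the junk entry 0 below. *)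
Definition ssyt_from (t : nat) (m : {ffun D -> 'I_M.+1}) : bool :=
  [forall x : D, if (t <= level (val x))%N then (0 < m x)%N else m x == ord0] &&
  [forall d, forall x : D, forall y : D,
     (t <= level (val x))%N && (val y == fw d (val x)) ==> fw_rel d (m x) (m y)].

Lemma ssyt_fromP t (m : {ffun D -> 'I_M.+1}) :
  reflect ((forall x : D, if (t <= level (val x))%N then (0 < m x)%N else m x == ord0)
    /\ (forall d (x y : D), (t <= level (val x))%N -> val y = fw d (val x) ->
          fw_rel d (m x) (m y)))
  (ssyt_from t m).
Proof.
apply: (iffP andP) => -[mx mxy]; split.
- exact/forallP.
- move=> d x y tx /eqP xy; move: mxy => /forallP/(_ d)/forallP/(_ x)/forallP/(_ y).
  by rewrite tx xy.
- exact/forallP.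
- apply/forallP => d; apply/forallP => x; apply/forallP => y.
  by apply/implyP => /andP[tx /eqP]; apply: mxy.
Qed.

Lemma ssyt_from0 (m : {ffun D -> 'I_M.+1}) : ssyt_from 0 m = semistandard m.
Proof.
apply/ssyt_fromP/and3P => [[m0 mxy]|[/forallP m0 /forallP md /forallP mr]].
  split; first exact/forallP.
    apply/forallP => x; apply/forallP => y; apply/implyP => /eqP yx.
    have := mxy false y x isT; rewrite /fw_rel eqbF_neg -ltnNge; apply.
    by rewrite yx /= /box_down /box_up /= addrK -surjective_pairing.
  apply/forallP => x; apply/forallP => y; apply/implyP => /eqP yx.
  by have := mxy true x y isT yx; rewrite /fw_rel eqb_id.
split=> // -[] x y _ yx; rewrite /fw_rel.
  rewrite eqb_id; have /forallP/(_ y) := mr x.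
  by rewrite yx eqxx.
have /forallP/(_ x) := md y.
rewrite yx /= /box_down /box_up /= addrNK -surjective_pairing eqxx /=.
by rewrite ltnNge; case: leq.
Qed.

(** Ribbon [j] occupies the levels [a j] to [b j], with box [pos j t] at level [t]. The hypotheses
    make the ribbons disjoint chains of steps [dir] that cover [D] and cannot be prolonged at their
    ends. *)
Variables (n : nat) (a b : 'I_n -> nat) (pos : 'I_n -> nat -> box).

Definition active (j : 'I_n) (t : nat) : bool := (a j <= t <= b j)%N.

Hypotheses (cvxD : order_convex D)
  (c0D : forall x, x \in D -> c0 < content x)
  (le_ab : forall j, (a j <= b j)%N)
  (posD : forall j t, active j t -> pos j t \in D)
  (pos_content : forall j t, active j t -> content (pos j t) = c0 + t%:Z)
  (posP : forall x, x \in D ->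
     exists j, active j (level x) && (pos j (level x) == x))
  (pos_inj : forall i j t, active i t -> active j t -> pos i t = pos j t -> i = j)
  (pos_fw : forall j t, (a j <= t < b j)%N -> pos j t.+1 = fw (dir t) (pos j t))
  (pos_end : forall j, fw (dir (b j)) (pos j (b j)) \notin D).

Lemma level_pos j t : active j t -> level (pos j t) = t.
Proof. by move=> jt; rewrite /level pos_content //; lia. Qed.

Lemma level_fw d x : x \in D -> level (fw d x) = (level x).+1.
Proof. by move=> /c0D; rewrite /level content_fw; lia. Qed.

Lemma level_gt0 x : x \in D -> (0 < level x)%N.
Proof. by move=> /c0D; rewrite /level; lia. Qed.

Lemma start_gt0 j : (0 < a j)%N.
Proof.
have jj : active j (a j) by rewrite /active leqnn le_ab.
by rewrite -(level_pos jj) level_gt0 ?posD.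
Qed.

(* The matrix B_t of the header; [v j] is the entry of the box of ribbon [j] at level [t]. *)
Definition transfer_mx (t : nat) (v : 'I_n -> 'I_M.+1) : 'M[A]_n :=
  \matrix_(i, j) if (b j < t)%N then green (a i) (b j)
                 else if (a j <= t)%N then amp (a i) t (v j) else (i == j)%:R.

Definition allowed (m : {ffun D -> 'I_M.+1}) (x : box) (s : 'I_M.+1) : bool :=
  [forall d, (fw d x \in D) ==> fw_rel d s (entry m (fw d x))].

Definition summed_mx (t : nat) (m : {ffun D -> 'I_M.+1}) : 'M[A]_n :=
  \matrix_(i, j) if (b j < t)%N then green (a i) (b j)
                 else if (a j <= t)%N
                   then \sum_(s : 'I_M.+1 | (0 < s)%N && allowed m (pos j t) s) amp (a i) t s
                   else (i == j)%:R.

(** Forgets the entries of level [t]; its fibres are the sets over which [sum_det_transfer] sums. *)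
Definition reset (t : nat) (m : {ffun D -> 'I_M.+1}) : {ffun D -> 'I_M.+1} :=
  [ffun x => if level (val x) == t then ord0 else m x].

(** With the later entries fixed, the boxes of level [t] constrain each other no further, being on
    one diagonal. A filling in the fibre is thus an independent choice of one entry per active
    ribbon, and [det_col_sum] applies. *)
Lemma sum_det_transfer t (m' : {ffun D -> 'I_M.+1}) : ssyt_from t.+1 m' ->
  \sum_(m | ssyt_from t m && (reset t m == m'))
     \det (transfer_mx t (fun j => entry m (pos j t)))
  = \det (summed_mx t m').
Proof.
move=> /ssyt_fromP[m'0 m'xy].
(* An inactive ribbon gets the single dummy entry 0, so that its column is summed exactly once. *)
pose Q j : pred 'I_M.+1 := [pred s : 'I_M.+1 | if active j t
   then (0 < s)%N && allowed m' (pos j t) s else s == ord0].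
pose F i j s := transfer_mx t (fun=> s) i j.
have -> : summed_mx t m' = \matrix_(i, j) \sum_(s | Q j s) F i j s.
  apply/matrixP => i j; rewrite !mxE /Q /=.
  under [RHS]eq_bigr do rewrite /F mxE.
  under [RHS]eq_bigl do rewrite /active [(t <= b j)%N]leqNgt.
  case: ifP => jt; first by rewrite andbF big_pred1_eq.
  by rewrite andbT; case: ifP => // _; rewrite big_pred1_eq.
rewrite det_col_sum.
have [rib ribP] : exists rib : D -> 'I_n, forall x : D,
    active (rib x) (level (val x)) && (pos (rib x) (level (val x)) == val x).
  have ex (x : D) := posP (valP x).
  by exists (fun x => xchoose (ex x)) => x; apply: (xchooseP (ex x)).
have posrib j (jt : active j t) : rib [` posD jt] = j.
  have /= := ribP [` posD jt]; rewrite level_pos // => /andP[r1 /eqP].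
  exact: pos_inj.
(* [h] writes the chosen entries on level [t] of [m']; [h'] reads them back. *)
pose h (g : {ffun 'I_n -> 'I_M.+1}) : {ffun D -> 'I_M.+1} :=
  [ffun x => if level (val x) == t then g (rib x) else m' x].
pose h' (m : {ffun D -> 'I_M.+1}) : {ffun 'I_n -> 'I_M.+1} :=
  [ffun j => if active j t then entry m (pos j t) else ord0].
have hK (g : {ffun 'I_n -> 'I_M.+1}) : (forall j, ~~ active j t -> g j = ord0) -> h' (h g) = g.
  move=> g0; apply/ffunP => j; rewrite ffunE; case: ifP => [jt|/negbT jt]; last by rewrite g0.
  by rewrite -[pos j t]/(val [` posD jt]) entry_val ffunE /= level_pos // eqxx posrib.
rewrite (reindex_onto h h') => [|m /andP[_ /eqP rm]]; last first.
  apply/ffunP => x; rewrite ffunE; case: ifP => [/eqP xt|xt].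
    have /andP[r1 /eqP r2] := ribP x.
    by rewrite ffunE -xt r1 r2 entry_val.
  by rewrite -rm ffunE xt.
have entryh (g : {ffun 'I_n -> 'I_M.+1}) j (jt : active j t) : entry (h g) (pos j t) = g j.
  by rewrite -[pos j t]/(val [` posD jt]) entry_val ffunE /= level_pos // eqxx posrib.
have entryh' (g : {ffun 'I_n -> 'I_M.+1}) d x : x \in D -> level x = t ->
    entry (h g) (fw d x) = entry m' (fw d x).
  move=> xD xt; rewrite /entry; case: insubP => // y _ yE.
  by rewrite ffunE yE level_fw // xt gtn_eqF.
apply: eq_big => [g|g /andP[/andP[_ _] /eqP hg]]; last first.
  congr (\det _); apply/matrixP => i j; rewrite !mxE /F mxE.
  case: ifP => jb; first by [].
  by case: ifP => ta; rewrite ?entryh // /active ta leqNgt jb.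
apply/andP/familyP => [[/andP[/ssyt_fromP[hg0 hgxy] _] /eqP hg] j|gQ].
  rewrite inE; case: ifP => [jt|jt]; last by rewrite -hg ffunE jt.
  have := hg0 [` posD jt]; rewrite /= level_pos // leqnn -entry_val entryh // => ->.
  apply/forallP => d; apply/implyP => fD.
  have := hgxy d [` posD jt] [` fD]; rewrite /= level_pos // leqnn => /(_ isT erefl).
  by rewrite -!entry_val /= entryh // entryh' ?posD ?level_pos.
have g0 j : ~~ active j t -> g j = ord0.
  by move=> jt; have := gQ j; rewrite inE (negbTE jt) => /eqP.
rewrite hK //; split=> //; apply/andP; split; last first.
  apply/eqP/ffunP => x; rewrite !ffunE; case: eqP => // xt.
  by have := m'0 x; rewrite xt ltnn => /eqP.
apply/ssyt_fromP; split=> [x|d x y tx yx].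
  rewrite ffunE; have := m'0 x; case: (ltngtP t (level (val x))) => // xt m'x.
  have /andP[r1 _] := ribP x.
  by have := gQ (rib x); rewrite inE xt r1 => /andP[].
rewrite !ffunE yx level_fw ?(valP x) // [_.+1 == t]gtn_eqF ?ltnS //.
case: eqP => [xt|xt]; last first.
  by apply: (m'xy d x y _ yx); rewrite ltn_neqAle tx andbT eq_sym; apply/eqP.
have /andP[r1 /eqP r2] := ribP x.
have := gQ (rib x); rewrite inE -xt r1 => /andP[_ /forallP/(_ d)].
by rewrite r2 -yx (valP y) entry_val.
Qed.

(** The transfer matrix of level [t.+1] before its active columns are multiplied by the weights
    [w]. *)
Definition next_mx (t : nat) (m : {ffun D -> 'I_M.+1}) : 'M[A]_n :=
  \matrix_(i, j) if (b j < t.+1)%N then green (a i) (b j)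
    else if (a j <= t.+1)%N then (a i == t.+1)%:R
      + \sum_(s : 'I_M.+1 | (0 < s)%N && fw_rel (dir t) s (entry m (pos j t.+1)))
          amp (a i) t s
    else (i == j)%:R.

(** The ribbon through [z] either ends there, against [pos_end], or steps to the start of [i]; in
    the latter case it is [i] itself, which has no box at level [t]. *)
Lemma start_no_pred i z t :
  a i = t.+1 -> z \in D -> pos i t.+1 <> fw (dir t) z.
Proof.
move=> ait zD posz.
have it : active i t.+1 by rewrite /active -ait leqnn le_ab.
have zt : level z = t.
  by apply: succn_inj; rewrite -(level_fw (dir t) zD) -posz level_pos.
have [k /andP[]] := posP zD; rewrite zt => kt /eqP zE.
have /andP[ak] := kt; rewrite leq_eqVlt => /orP[/eqP tb|tb].
  by have := pos_end k; rewrite -tb zE -posz posD.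
have kt1 : active k t.+1 by rewrite /active tb ltnW.
have ki : k = i by apply: (pos_inj kt1 it); rewrite pos_fw ?ak // zE.
by move: ak; rewrite ki ait ltnn.
Qed.

Lemma start_uniq i j t : a i = t.+1 -> a j = t.+1 -> i = j.
Proof.
move=> ait ajt.
have it : active i t.+1 by rewrite /active -ait leqnn le_ab.
have jt : active j t.+1 by rewrite /active -ajt leqnn le_ab.
apply: (pos_inj it jt); apply/eqP/negPn/negP => ij.
have cij : content (pos j t.+1) = content (pos i t.+1) by rewrite !pos_content.
have [z zD []] := order_convex_source (dir t) cvxD (posD it) (posD jt) cij ij.
  exact: start_no_pred.
exact: start_no_pred.
Qed.

(** Compare both with the corner box above the right neighbour: up [<=] corner [<] right. *)
Lemma entry_corner t (m : {ffun D -> 'I_M.+1}) x : ssyt_from t.+1 m -> x \in D ->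
  level x = t -> fw true x \in D -> fw false x \in D ->
  (entry m (fw false x) < entry m (fw true x))%N.
Proof.
move=> /ssyt_fromP[_ mxy] xD xt rD uD.
have cD := order_convex_corner cvxD rD uD.
have leux : fw_rel true (m [` uD]) (m [` cD]).
  by apply: mxy => //; rewrite -[val _]/(fw false x) level_fw // xt.
have ltxr : fw_rel false (m [` rD]) (m [` cD]).
  apply: mxy; first by rewrite -[val _]/(fw true x) level_fw // xt.
  by congr (_, _) => /=; lia.
rewrite -[fw false x]/(val [` uD]) -[fw true x]/(val [` rD]) !entry_val.
move: leux ltxr; rewrite /fw_rel eqb_id eqbF_neg -ltnNge; exact: leq_ltn_trans.
Qed.

(** The excluded entries therefore lie among those compatible with the strip step, so the allowed
    entries form a genuine set difference. *)
Lemma fw_rel_corner t (m : {ffun D -> 'I_M.+1}) d s x :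
  ssyt_from t.+1 m -> x \in D -> level x = t -> fw (~~ d) x \in D ->
  fw_rel d s (entry m (fw (~~ d) x)) ->
  (fw d x \in D) ==> fw_rel d s (entry m (fw d x)).
Proof.
move=> mt xD xt bD sb; apply/implyP => fD; move: bD fD sb; rewrite /fw_rel.
case: d => /= bD fD; have := entry_corner mt xD xt; rewrite /= => /(_ _ _)/=.
  by move=> /(_ fD bD) lt; rewrite !eqb_id => le; apply: leq_trans le (ltnW lt).
by move=> /(_ bD fD) lt; rewrite !eqbF_neg -!ltnNge; apply: ltn_trans.
Qed.

(** Column operations [L] subtract from the column of [j] that of the ribbon through its off-strip
    neighbour. Row operations [1%:M + K] account for a ribbon starting at [t.+1], whose column in
    [summed_mx] is still a Kronecker delta. *)
Lemma det_summed t m : ssyt_from t.+1 m ->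
  \det (summed_mx t m) = \det (next_mx t m).
Proof.
move=> mt; set d := dir t.
pose lo i j := \sum_(s : 'I_M.+1 | (0 < s)%N &&
  ((fw (~~ d) (pos j t) \in D) && fw_rel d s (entry m (fw (~~ d) (pos j t))))) amp (a i) t s.
pose hi i j := \sum_(s : 'I_M.+1 | (0 < s)%N &&
  ((fw d (pos j t) \in D) ==> fw_rel d s (entry m (fw d (pos j t))))) amp (a i) t s.
(* The entries allowed in box x = [pos j t] are those compatible with the next box
   along the strip, minus those compatible with the other neighbour of x. *)
have summedE i j : active j t -> summed_mx t m i j = hi i j - lo i j.
  move=> jt; have /andP[aj bj] := jt.
  rewrite mxE ltnNge bj aj /=; apply/eqP; rewrite eq_sym subr_eq; apply/eqP.
  rewrite /hi (bigID (fun s : 'I_M.+1 => (fw (~~ d) (pos j t) \in D)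
    && fw_rel d s (entry m (fw (~~ d) (pos j t))))) /= addrC.
  congr (_ + _); apply: eq_bigl => s; rewrite -andbA; congr (_ && _).
    apply/andP/forallP => [[hs ls] d'|al].
      have [->|dd'] := eqVneq d' d; first by [].
      have -> : d' = ~~ d by move: dd'; case: (d'); case: (d).
      by rewrite fw_relN implybE -negb_and.
    by split; [exact: al | have := al (~~ d); rewrite fw_relN implybE -negb_and].
  apply/andP/idP => [[_ //]|/andP[bD ls]]; rewrite bD ls; split=> //.
  by apply: (fw_rel_corner mt) => //; rewrite ?posD // level_pos.
(* If [j] ends at level [t], then [pos_end] makes the constraint in [hi] void, and [hi] is the full
   sum in [green]. *)
have nextE i j : active j t -> next_mx t m i j = (a i == t.+1)%:R + hi i j.
  move=> jt; have /andP[aj bj] := jt; rewrite mxE ltnS leqNgt.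
  have [tb|bt] /= := ltnP t (b j).
    rewrite (leqW aj) pos_fw ?aj // /hi -[dir t]/d.
    suff -> : fw d (pos j t) \in D by [].
    by rewrite -pos_fw ?aj // posD // /active tb ltnW.
  have bE : b j = t by apply/eqP; rewrite eqn_leq bt bj.
  rewrite /green bE /hi (negbTE (_ : fw d (pos j t) \notin D)).
    by under [in RHS]eq_bigl do rewrite andbT.
  by rewrite /d -bE pos_end.
(* [p] is the ribbon of the neighbour of [pos j t] off the strip; its column of
   [next_mx] is what [lo] subtracts. *)
pose pred_of j p := [&& active j t, fw (~~ d) (pos j t) \in D, active p t.+1
                      & pos p t.+1 == fw (~~ d) (pos j t)].
pose L : 'M[A]_n := \matrix_(p, j) ((p == j)%:R - (pred_of j p)%:R).
pose K : 'M[A]_n := \matrix_(i, l)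
  (if (a l == t.+1) && (a i <= t)%N then
     \sum_(s : 'I_M.+1 | (0 < s)%N && fw_rel d s (entry m (pos l t.+1))) amp (a i) t s
   else 0).
(* For the ribbons related by [pred_of], [y p] is the box at level [t.+1] that [p] occupies or would
   reach by one more strip step. Its row, with a sign depending on [d], orders them along the
   diagonal and makes [L] triangular. *)
pose y p := if (a p <= t)%N then fw d (pos p t) else pos p t.+1.
pose rk p : int := if d then (y p).1 else - (y p).1.
have rk_lt p j : pred_of j p -> rk p < rk j.
  move=> /and4P[/andP[aj bj] _ /andP[ap bp] /eqP posp].
  have yp : y p = fw (~~ d) (pos j t).
    by rewrite -posp /y; case: ifP => // apt; rewrite pos_fw ?apt.
  have yj : y j = fw d (pos j t) by rewrite /y aj.
  by rewrite /rk yp yj; case: (d) => /=; lia.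
have detL : \det L = 1.
  apply: (@det_unitriangular _ _ rk) => [p|p j pj]; rewrite !mxE.
    case pp: (pred_of p p); last by rewrite eqxx subr0.
    by have := rk_lt _ _ pp; rewrite ltxx.
  rewrite (negbTE pj) sub0r oppr_eq0.
  by case pp: (pred_of j p); [move=> _; apply: rk_lt | rewrite eqxx].
have detK : \det (1%:M + K) = 1.
  apply: (@det_unitriangular _ _ (fun i => (a i)%:Z)) => [i|i l il].
    rewrite !mxE eqxx; case: andP => [[/eqP-> ]|_]; rewrite ?ltnn // addr0 //.
  rewrite !mxE (negbTE il) add0r; case: andP => [[/eqP-> ait] _|]; last by rewrite eqxx.
  by rewrite ltz_nat.
suff CL : next_mx t m *m L = (1%:M + K) *m summed_mx t m.
  by have := congr1 determinant CL; rewrite !det_mulmx detL detK mul1r mulr1.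
apply/matrixP => i j.
rewrite mulmxDl mul1mx [RHS]mxE [in LHS]mxE.
have -> : \sum_k next_mx t m i k * L k j
    = next_mx t m i j - \sum_(k | pred_of j k) next_mx t m i k.
  rewrite (eq_bigr (fun k => (if k == j then next_mx t m i k else 0)
     - (if pred_of j k then next_mx t m i k else 0))) => [|k _].
    by rewrite sumrB -!big_mkcond /= big_pred1_eq.
  by rewrite [L k j]mxE mulrBr; do 2 case: ifP => _; rewrite ?mulr1 ?mulr0.
(* Active column: [K] uses only rows of ribbons starting at [t.+1], which vanish here. *)
have [jt|jt] := boolP (active j t).
  have -> : (K *m summed_mx t m) i j = 0.
    rewrite mxE big1 // => l _; rewrite [K i l]mxE.
    case: andP => [[/eqP al _]|_]; last by rewrite mul0r.
    rewrite summedE // [hi l j]big1 ?[lo l j]big1 ?subrr ?mulr0 // => s _;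
      by rewrite amp_eq0 ?al.
  rewrite addr0 nextE // summedE //.
  (* If the off-strip neighbour is in [D], the terms [a i == t.+1] of the two columns cancel.
     Otherwise [order_convex_step] gives a start at level [t.+1] a predecessor, which
     [start_no_pred] forbids. *)
  have [bD|bD] := boolP (fw (~~ d) (pos j t) \in D).
    have [p] := posP bD; rewrite level_fw ?posD // level_pos // => /andP[pt /eqP posp].
    have -> : \sum_(k | pred_of j k) next_mx t m i k = next_mx t m i p.
      rewrite (big_pred1 p) // => k; apply/and4P/eqP => [[_ _ kt /eqP posk]|->].
        by apply: (pos_inj kt pt); rewrite posk posp.
      by split=> //; rewrite posp.
    have /andP[ap bp] := pt; rewrite [next_mx _ _ _ _]mxE ltnNge bp ap /= posp.
    by rewrite opprD addrACA subrr add0r /lo bD.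
  have -> : lo i j = 0.
    by rewrite /lo big1 // => s; rewrite (negbTE bD) andbF.
  rewrite big_pred0 => [|k]; last by rewrite /pred_of (negbTE bD) andbF.
  rewrite !subr0; case: eqP => [ait|_]; last by rewrite add0r.
  have it : active i t.+1 by rewrite /active -ait leqnn le_ab.
  have cij : content (pos i t.+1) = content (pos j t) + 1.
    by rewrite !pos_content //; lia.
  have [] := order_convex_step d cvxD (posD jt) (posD it) cij.
    by rewrite (negbTE bD).
  by case=> z zD /(start_no_pred ait zD).
rewrite big_pred0 => [|k]; last by rewrite /pred_of (negbTE jt).
(* Finished ribbons keep their [green] column; [K] adds only [green] from [t.+1] to an end before
   [t], which is 0. *)
rewrite subr0; have [bt|tb] := ltnP (b j) t.
  rewrite mxE leqW // [summed_mx t m i j]mxE bt [X in _ + X]mxE big1 ?addr0 // => l _.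
  rewrite [K i l]mxE; case: andP => [[/eqP al _]|_]; last by rewrite mul0r.
  by rewrite mxE bt green_eq0 ?mulr0 // al.
have ta : (t < a j)%N by move: jt; rewrite /active tb andbT -ltnNge.
have sE l : summed_mx t m l j = (l == j)%:R.
  by rewrite mxE ltnNge tb leqNgt ta.
have -> : (K *m summed_mx t m) i j = K i j.
  rewrite mxE (bigD1 j) //= sE eqxx mulr1 big1 ?addr0 // => l lj.
  by rewrite sE (negbTE lj) mulr0.
rewrite sE !mxE ltnS leqNgt (leq_trans ta (le_ab j)) /=.
(* A ribbon starting now: its [next_mx] column is that of [1%:M + K], as [start_uniq] turns
   [a i == t.+1] into [i == j]. *)
have [at1|nat1] := eqVneq (a j) t.+1; last first.
  by rewrite leq_eqVlt (negbTE nat1) ltnS leqNgt ta addr0.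
rewrite at1 leqnn; congr (_ + _).
  have [->|ij] := eqVneq i j; first by rewrite at1 eqxx.
  by case: eqP => // ai; rewrite (start_uniq ai at1) eqxx in ij.
case: ifP => // /negbT; rewrite -ltnNge => ai.
by rewrite big1 // => s _; rewrite amp_eq0.
Qed.

(** Each active column carries the weight of its box as a factor, and active ribbons correspond to
    the boxes of level [t.+1]. *)
Lemma det_transferS t (m : {ffun D -> 'I_M.+1}) :
  \det (transfer_mx t.+1 (fun j => entry m (pos j t.+1)))
  = (\prod_(x : D | level (val x) == t.+1) w (level (val x)) (m x))
    * \det (next_mx t m).
Proof.
pose u j := if active j t.+1 then w t.+1 (entry m (pos j t.+1)) else 1.
have -> : transfer_mx t.+1 (fun j => entry m (pos j t.+1))
    = next_mx t m *m diag_mx (\row_j u j).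
  apply/matrixP => i j; rewrite mul_mx_diag !mxE /u /active.
  have [bt|tb] := ltnP (b j) t.+1; first by rewrite andbF mulr1.
  by rewrite andbT; case: ifP => _; rewrite ?mulr1 //= mulrC.
rewrite det_mulmx det_diag mulrC; congr (_ * _).
under eq_bigr do rewrite mxE.
rewrite /u -big_mkcond /=.
have act (x : D) := posP (valP x).
pose rib (x : D) := xchoose (act x).
have ribP x : active (rib x) (level (val x)) /\ pos (rib x) (level (val x)) = val x.
  by have /andP[? /eqP] := xchooseP (act x).
rewrite [RHS](partition_big rib (fun j => active j t.+1)) /= => [|x /eqP <-]; last first.
  by have [] := ribP x.
apply: eq_bigr => j jt; rewrite (big_pred1 [` posD jt]) => [|x].
  by rewrite level_pos // -entry_val.
apply/andP/eqP => [[/eqP xt /eqP xj]|->].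
  by apply/val_inj; have [_] := ribP x; rewrite xt xj => <-.
have /= := ribP [` posD jt]; rewrite level_pos // => -[rt posr].
by split=> //; apply/eqP; apply: (pos_inj rt jt).
Qed.

(** Interpolates between the two sides: at [t = 0] the matrix is the identity and the product runs
    over all boxes; beyond the last level only the zero filling remains and every column is
    [green]. *)
Definition partial_sum (t : nat) : A :=
  \sum_(m | ssyt_from t m)
    (\prod_(x : D | (t < level (val x))%N) w (level (val x)) (m x))
    * \det (transfer_mx t (fun j => entry m (pos j t))).

Lemma partial_sumS t : partial_sum t = partial_sum t.+1.
Proof.
rewrite /partial_sum (partition_big (reset t) (ssyt_from t.+1)) => [|m mt] /=; last first.
  have /ssyt_fromP[m0 mxy] := mt.
  apply/ssyt_fromP; split=> [x|d x y tx yx].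
    by have := m0 x; rewrite ffunE; case: (ltngtP t (level (val x))).
  have xD := valP x; rewrite !ffunE yx level_fw //.
  by rewrite !gtn_eqF ?mxy // ltnW // ltnW.
apply: eq_bigr => m' m't; rewrite det_transferS -det_summed // -sum_det_transfer //.
rewrite mulrA.
under eq_bigr => m /andP[_ /eqP rm].
  rewrite (eq_bigr (fun x => w (level (val x)) (m' x))) => [|x tx]; last first.
    by rewrite -rm ffunE gtn_eqF.
  over.
rewrite -big_distrr /=; congr (_ * _).
rewrite (bigID (fun x : D => level (val x) == t.+1)) /= mulrC; congr (_ * _).
  by apply: eq_bigl => x; rewrite [RHS]ltn_neqAle eq_sym andbC.
by apply: eq_bigl => x; case: eqP => [->|]; rewrite ?ltnSn ?andbF.
Qed.

Lemma sum_det_green :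
  \sum_(m : {ffun D -> 'I_M.+1} | semistandard m)
     \prod_(x : D) w (level (val x)) (m x)
  = \det (\matrix_(i, j) green (a i) (b j)).
Proof.
have -> : \sum_(m : {ffun D -> 'I_M.+1} | semistandard m)
     \prod_(x : D) w (level (val x)) (m x) = partial_sum 0.
  apply: eq_big => [m|m _]; first by rewrite ssyt_from0.
  have -> : transfer_mx 0 (fun j => entry m (pos j 0)) = 1%:M.
    by apply/matrixP => i j; rewrite !mxE ltn0 leqNgt start_gt0.
  rewrite det1 mulr1; apply: eq_bigl => x.
  by rewrite level_gt0 // (valP x).
pose T := (\max_j b j).+1.
have bT j : (b j < T)%N by rewrite ltnS leq_bigmax.
have -> : partial_sum 0 = partial_sum T.
  by elim: (T) => // t ->; rewrite partial_sumS.
have lT (x : D) : (level (val x) < T)%N.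
  by have [j /andP[/andP[_ xb] _]] := posP (valP x); apply: leq_ltn_trans xb _.
rewrite /partial_sum (big_pred1 [ffun=> ord0]) => [|m]; last first.
  apply/ssyt_fromP/eqP => [[m0 _]|->]; last first.
    by split=> [x|d x y]; rewrite leqNgt lT // ffunE.
  by apply/ffunP => x; have := m0 x; rewrite leqNgt lT ffunE => /eqP.
rewrite big_pred0 => [|x]; last by rewrite ltnNge ltnW.
rewrite mul1r; congr (\det _); apply/matrixP => i j.
by rewrite !mxE bT.
Qed.

End Transfer.

(** * The determinant for a set of boxes cut into chains *)

Lemma levelK c0 x : c0 < content x -> c0 + (level c0 x)%:Z = content x.
Proof. by rewrite /level; lia. Qed.

(** Contents replace levels here, so that the result applies both to the decomposition of the
    diagram and to a single subribbon of the strip. *)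
Lemma schur_sum_chains (A : comPzRingType) (f : nat -> nat -> A) (M : nat)
    (kappa : int -> nat) (dir : int -> bool) (c0 : int) (D : {fset box}) (n : nat)
    (Theta : 'I_n -> {fset box}) (al be : 'I_n -> int) (s : 'I_n -> box)
    (k : {ffun D -> nat}) :
  order_convex D ->
  (forall x, x \in D -> c0 < content x) ->
  (forall x, reflect (exists j, x \in Theta j) (x \in D)) ->
  (forall i j x, x \in Theta i -> x \in Theta j -> i = j) ->
  (forall j, s j \in Theta j /\ content (s j) = al j) ->
  (forall j x, x \in Theta j -> al j <= content x <= be j) ->
  (forall j x y, x \in Theta j -> y \in Theta j -> content x = content y -> x = y) ->
  (forall j x, x \in Theta j -> content x < be j -> fw (dir (content x)) x \in Theta j) ->
  (forall j x, x \in Theta j -> content x = be j -> fw (dir (content x)) x \notin D) ->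
  (forall x : D, k x = kappa (content (val x))) ->
  schur_sum f M.+1 k
  = \det (\matrix_(i, j) green (fun t (v : 'I_M.+1) => f v (kappa (c0 + t%:Z)))
      (fun t => dir (c0 + t%:Z)) `|al i - c0|%N `|be j - c0|%N).
Proof.
move=> cvxD c0D DE inj sP albe cinj fwP endP kE.
pose a j := `|al j - c0|%N; pose b j := `|be j - c0|%N.
have ab j : c0 < al j <= be j.
  have [sj cs] := sP j; have /andP[_] := albe _ _ sj; rewrite -cs => ->.
  by rewrite andbT c0D //; apply/DE; exists j.
(* Follow the strip from the starting box; up to the starting level [pos j] stays at [s j]. *)
pose pos j := fix pos t := if t is t'.+1
  then (if (t' < a j)%N then s j else fw (dir (c0 + t'%:Z)) (pos t')) else s j.
have posS j t : pos j t.+1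
  = if (t < a j)%N then s j else fw (dir (c0 + t%:Z)) (pos j t) by [].
have posE j t : active a b j t -> pos j t \in Theta j /\ content (pos j t) = c0 + t%:Z.
  elim: t => [|t IHt] /andP[].
    by move=> aj bj; have := ab j; move: aj; rewrite /a; lia.
  rewrite posS; have [ta at'|at' _ tb] := ltnP t (a j).
    have [sj cs] := sP j; split=> //; rewrite cs.
    by have := ab j; move: ta at'; rewrite /a; lia.
  have [|pT pc] := IHt; first by rewrite /active at' ltnW.
  have pb : content (pos j t) < be j.
    by rewrite pc; have := ab j; move: tb; rewrite /b; lia.
  split; first by rewrite -pc fwP.
  by rewrite content_fw pc; lia.
rewrite /schur_sum -(@sum_det_green _ _ _ _ c0 D n a b pos) //.
- apply: eq_bigr => m _; apply: eq_bigr => x _; rewrite kE; congr (f _ (kappa _)).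
  by rewrite levelK ?c0D ?(valP x).
- by move=> j; have := ab j; rewrite /a /b; lia.
- by move=> j t /posE[pT _]; apply/DE; exists j.
- by move=> j t /posE[].
- move=> x /DE[j xj]; exists j.
  have xD : x \in D by apply/DE; exists j.
  have jx : active a b j (level c0 x).
    by have := albe _ _ xj; have := ab j; rewrite /active /a /b /level; lia.
  rewrite jx; apply/eqP; have [pT pc] := posE _ _ jx; apply: (cinj j) => //.
  by rewrite pc; have := c0D _ xD; rewrite /level; lia.
- by move=> i j t /posE[pi _] /posE[pj _] pij; apply: (inj _ _ _ pi); rewrite pij.
- by move=> j t /andP[at' _]; rewrite posS ltnNge at'.
- move=> j; have [|pT pc] := posE j (b j).
    by have := ab j; rewrite /active /a /b; lia.
  by rewrite -pc (endP j) // pc; have := ab j; rewrite /b; lia.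
Qed.

(** * Empty strips and extremal contents *)

Lemma green_succ (A : comPzRingType) M (w : nat -> 'I_M.+1 -> A) dir b :
  green w dir b.+1 b = 1.
Proof. by rewrite /green eqxx big1 ?addr0 // => s _; rewrite amp_eq0. Qed.

Lemma schur_sum_empty (A : comPzRingType) (f : nat -> nat -> A) M (D : {fset box})
    (k : {ffun D -> nat}) : D = fset0 -> schur_sum f M k = 1.
Proof. by move=> D0; move: k; rewrite D0 => k; apply: schur_sum_fset0. Qed.

Lemma min_contentP (D : {fset box}) : D != fset0 ->
  (exists2 x, x \in D & content x = min_content D) /\
  (forall x, x \in D -> min_content D <= content x).
Proof.
move=> /fset0Pn[x0 x0D]; rewrite /min_content.
have srt : sorted <=%R (sort <=%R (contents D)) by apply: sort_sorted; exact: le_total.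
have memE c : (c \in sort <=%R (contents D)) = (c \in contents D) by rewrite mem_sort.
case: (sort _ _) srt memE => [|c l] /= srt memE.
  by have := memE (content x0); rewrite in_imfset.
split=> [|x xD].
  have := memE c; rewrite inE eqxx => /esym/imfsetP[x /= xD ->].
  by exists x.
have := memE (content x); rewrite in_imfset // inE => /orP[/eqP -> //|xl].
by move: srt; rewrite (path_sortedE le_trans) => /andP[/allP le_c _]; apply: le_c.
Qed.

Lemma max_contentP (D : {fset box}) : D != fset0 ->
  (exists2 x, x \in D & content x = max_content D) /\
  (forall x, x \in D -> content x <= max_content D).
Proof.
move=> /fset0Pn[x0 x0D]; rewrite /max_content.
have srt : sorted <=%R (sort <=%R (contents D)) by apply: sort_sorted; exact: le_total.
have memE c : (c \in sort <=%R (contents D)) = (c \in contents D) by rewrite mem_sort.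
case/lastP: (sort _ _) srt memE => [|l c] /= srt memE.
  by have := memE (content x0); rewrite in_imfset.
rewrite last_rcons; split=> [|x xD].
  have := memE c; rewrite mem_rcons inE eqxx => /esym/imfsetP[x /= xD ->].
  by exists x.
have := memE (content x); rewrite in_imfset // mem_rcons inE => /orP[/eqP -> //|xl].
move: srt; rewrite -rev_sorted rev_rcons /= (path_sortedE ge_trans) => /andP[/allP le_c _].
by apply: le_c; rewrite mem_rev.
Qed.

(** * Geometry of skew diagrams and ribbons *)

Lemma partition_nth_le lam i j : is_partition lam -> (i <= j)%N ->
  ((lam`_j)%R <= (lam`_i)%R)%N.
Proof.
move=> /andP[srt _] ij; have [jl|lj] := ltnP j (size lam); last by rewrite nth_default.
have geq_trans : transitive geq by move=> y x z /= xy yz; apply: leq_trans yz xy.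
apply: (sorted_leq_nth geq_trans (fun x => leqnn x) 0 srt); rewrite ?inE //.
exact: leq_ltn_trans ij jl.
Qed.

(** The row of [z] is weakly below that of [x], where [mu] is no larger, and weakly above that of
    [y], where [lam] is no smaller. *)
Lemma skew_diagram_convex D : is_skew_diagram D -> order_convex D.
Proof.
move=> [lam [mu [lamP muP _ ->]]] x y [z1 z2].
rewrite !inE => /allpairsPdep[i [j [+ + ->]]] /allpairsPdep[i' [j' [+ + ->]]] /= hi hj.
rewrite !mem_index_iota !mem_iota !add0n /= => il jl il' jl'.
have z1E : z1 = (`|z1|%N.-1.+1)%:Z by lia.
have z2E : z2 = `|z2|%N%:Z by lia.
apply/allpairsPdep; exists `|z1|%N.-1, `|z2|%N.
rewrite mem_iota mem_index_iota -z1E -z2E add0n /=.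
have zi : (i <= `|z1|%N.-1 <= i')%N by lia.
have /andP[iz zi'] := zi; have /andP[mj _] := jl; have /andP[_ jl2] := jl'.
split=> //; first by lia.
apply/andP; split.
  apply: leq_ltn_trans (partition_nth_le muP iz) _.
  by apply: leq_trans mj _; lia.
rewrite ltnS; apply: leq_trans (partition_nth_le lamP zi').
by rewrite ltnS in jl2; apply: leq_trans jl2; lia.
Qed.

Lemma ribbon_convex R : is_ribbon R -> order_convex R.
Proof. by case=> /skew_diagram_convex. Qed.

(** Convexity would fill a 2 by 2 square at [x]. *)
Lemma ribbon_no_square R x y : is_ribbon R -> x \in R -> y \in R ->
  ~ (x.1 < y.1 /\ x.2 < y.2).
Proof.
case: x y => [x1 x2] [y1 y2] RR xR yR [/= lt1 lt2].
have [_ _ /(_ (x1, x2))/and4P[]] := RR.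
by split=> //; apply: (ribbon_convex RR xR yR) => /=; lia.
Qed.

Lemma ribbon_content_inj R : is_ribbon R -> {in R &, injective content}.
Proof.
move=> RR [x1 x2] [y1 y2] xR yR; rewrite /content /= => cxy.
have := ribbon_no_square RR xR yR; have := ribbon_no_square RR yR xR => /= n1 n2.
by congr (_, _); lia.
Qed.

Lemma ribbon_next R x y : is_ribbon R -> x \in R -> y \in R ->
  content y = content x + 1 -> y = fw true x \/ y = fw false x.
Proof.
move=> RR; case: x y => [x1 x2] [y1 y2] xR yR; rewrite /content /= => cxy.
have := ribbon_no_square RR xR yR; have := ribbon_no_square RR yR xR => /= n1 n2.
have [y1E|y1E] : y1 = x1 \/ y1 = x1 - 1 by lia.
  by left; congr (_, _) => /=; lia.
by right; congr (_, _) => /=; lia.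
Qed.

Lemma edge_adjacent_content x y : edge_adjacent x y ->
  content y = content x + 1 \/ content y = content x - 1.
Proof.
case: x y => [x1 x2] [y1 y2]; rewrite /edge_adjacent /content /= !xpair_eqE /=.
by lia.
Qed.

(** Adjacent contents differ by 1. If [content x + 1] were missed, the boxes of content at most
    [content x] would be closed under adjacency and [y] unreachable. *)
Lemma edge_connected_next R x y : edge_connected R -> x \in R -> y \in R ->
  content x < content y -> exists2 z, z \in R & content z = content x + 1.
Proof.
move=> conR xR yR xy.
have [/existsP[z /eqP zE]|/existsPn no] :=
  boolP [exists z : R, content (val z) == content x + 1].
  by exists (val z) => //; apply: valP.
pose P : {pred R} := fun u => content (val u) <= content x.
have clP : closed [rel u v : R | edge_adjacent (val u) (val v)] P.
  move=> u v /= uv; rewrite !unfold_in /P.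
  have := no u; have := no v; have := edge_adjacent_content uv.
  move: (content (val u)) (content (val v)) (content x) => cu cv cx; lia.
have := closed_connect clP (conR [` xR] [` yR]).
by rewrite !unfold_in /P /= lexx leNgt xy.
Qed.

(** The value is [false] (up) also where [R] has no next box. *)
Definition ribbon_dir (R : {fset box}) (c : int) : bool :=
  [exists r : R, (content (val r) == c) && (box_right (val r) \in R)].

Lemma ribbon_dirE R d x : is_ribbon R -> x \in R -> fw d x \in R ->
  ribbon_dir R (content x) = d.
Proof.
move=> RR xR; case: d => fR.
  by apply/existsP; exists [` xR]; rewrite /= eqxx.
apply/existsP => -[r /andP[/eqP rx rR]].
have rE : val r = x by apply: (ribbon_content_inj RR) => //; apply: valP.
rewrite rE -/(fw true x) in rR.
have := ribbon_content_inj RR rR fR; rewrite !content_fw => /(_ erefl) [].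
by move=> /= E; lia.
Qed.

Lemma ribbon_fw R x y : is_ribbon R -> x \in R -> y \in R ->
  content y = content x + 1 -> y = fw (ribbon_dir R (content x)) x.
Proof.
move=> RR xR yR cxy; have [yE|yE] := ribbon_next RR xR yR cxy; rewrite yE in yR *;
  by rewrite (ribbon_dirE RR xR yR).
Qed.

(** Without squares, comparable boxes share a row or a column, so the contents between them stay in
    the range. *)
Lemma subribbon_convex R a b : is_ribbon R -> order_convex (subribbon R a b).
Proof.
move=> RR [x1 x2] [y1 y2] [z1 z2]; rewrite !inE /= => /andP[xR xab] /andP[yR yab] h1 h2.
rewrite (ribbon_convex RR xR yR) //=.
by have /= := ribbon_no_square RR xR yR; move: xab yab h1 h2; rewrite /content /=; lia.
Qed.

Lemma content_dshift t x : content (dshift t x) = content x.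
Proof. by rewrite /content /=; lia. Qed.

Lemma dshift_fw t d x : dshift t (fw d x) = fw d (dshift t x).
Proof. by case: d; congr (_, _) => /=; lia. Qed.

Lemma dshift_inj t : injective (dshift t).
Proof. by move=> [x1 x2] [y1 y2] [] /= e1 e2; congr (_, _); lia. Qed.

Lemma diag_valueE (D : {fset box}) (k : {ffun D -> nat}) x :
  diag_constant k -> k x = diag_value k (content (val x)).
Proof.
move=> kD; rewrite /diag_value; case: pickP => [y /eqP xy|/(_ x)]; last by rewrite eqxx.
exact: kD.
Qed.

Lemma contentsP (D : {fset box}) c :
  reflect (exists2 x, x \in D & content x = c) (c \in contents D).
Proof.
rewrite /contents; apply: (iffP (imfsetP _ _ _ _)) => [[x /= xD ->]|[x xD <-]]; by exists x.
Qed.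

Lemma schur_sum_subribbon (A : comPzRingType) (f : nat -> nat -> A) (M : nat)
    (kappa : int -> nat) (c0 : int) (R : {fset box}) (a b : int)
    (k : {ffun subribbon R a b -> nat}) :
  is_ribbon R -> a \in contents R -> b \in contents R -> a <= b ->
  (forall x, x \in R -> c0 < content x) ->
  (forall x, k x = kappa (content (val x))) ->
  schur_sum f M.+1 k
  = green (fun t (v : 'I_M.+1) => f v (kappa (c0 + t%:Z)))
      (fun t => ribbon_dir R (c0 + t%:Z)) `|a - c0|%N `|b - c0|%N.
Proof.
move=> RR /contentsP[x xR xa] /contentsP[y yR yb] ab c0R kE.
have in_sub z : (z \in subribbon R a b) = (z \in R) && (a <= content z <= b).
  by rewrite !inE.
rewrite (@schur_sum_chains _ f M kappa (ribbon_dir R) c0 _ 1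
  (fun=> subribbon R a b) (fun=> a) (fun=> b) (fun=> x)) //.
- by rewrite det_mx11 mxE.
- exact: subribbon_convex.
- by move=> z; rewrite in_sub => /andP[/c0R].
- by move=> z; apply: (iffP idP) => [zS|[]//]; exists ord0.
- by move=> i j z; rewrite !ord1.
- by move=> _; rewrite in_sub xR xa lexx ab.
- by move=> _ z; rewrite in_sub => /andP[].
- move=> _ z z'; rewrite !in_sub => /andP[zR _] /andP[zR' _].
  exact: (ribbon_content_inj RR).
- move=> _ z; rewrite !in_sub => /andP[zR zab] zb.
  have zy : content z < content y by rewrite yb.
  have [_ conR _] := RR; have [z' zR' cz] := edge_connected_next conR zR yR zy.
  by rewrite -(ribbon_fw RR zR zR' cz) zR' cz; lia.
- by move=> _ z _ zb; rewrite in_sub content_fw zb; lia.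
Qed.

(** * The ribbons as maximal chains along the cutting strip *)

Section CuttingStrip.
Variables (D : {fset box}) (n : nat) (Theta : 'I_n -> {fset box}) (R : {fset box}).
Hypotheses (ThetaD : outside_decomposition D Theta) (stripR : is_cutting_strip D Theta R).

Lemma mem_outside_decomposition x : reflect (exists j, x \in Theta j) (x \in D).
Proof.
have [_ DE _ _ _] := ThetaD; rewrite {1}DE.
apply: (iffP (bigfcupP _ _ _ _)) => [[j _ xj]|[j xj]]; exists j => //.
by rewrite mem_enum.
Qed.

(** Diagonal translation preserves contents and directions, so the step is read off the translate
    inside [R]. *)
Lemma strip_step j x : x \in Theta j -> content x < max_content (Theta j) ->
  fw (ribbon_dir R (content x)) x \in Theta j.
Proof.
move=> xT xm; have [/(_ j)[[_ conT _] T0] _ _ _ _] := ThetaD.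
have [RR _ /(_ j)[t tR] _] := stripR.
have [[z zT zm] _] := max_contentP T0.
have [|y yT cy] := edge_connected_next conT xT zT; first by rewrite zm.
have cxy : content (dshift t y) = content (dshift t x) + 1 by rewrite !content_dshift.
have := ribbon_fw RR (tR _ xT) (tR _ yT) cxy.
by rewrite content_dshift -dshift_fw => /dshift_inj <-.
Qed.

(** The last clause of [is_cutting_strip] directs the strip across the perimeter on which the ribbon
    ends; at the maximal content of [D] any step leaves [D]. *)
Lemma strip_end j x : x \in Theta j -> content x = max_content (Theta j) ->
  fw (ribbon_dir R (content x)) x \notin D.
Proof.
move=> xT xm; have [_ _ _ _ /(_ j x (conj xT xm)) out] := ThetaD.
have xD : x \in D by apply/mem_outside_decomposition; exists j.
have [_ maxD] := max_contentP (introT (fset0Pn D) (ex_intro _ x xD)).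
have [RR cRD _ end_dir] := stripR.
have [xmax|xmax] := eqVneq (content x) (max_content D).
  by apply/negP => /maxD; rewrite content_fw xmax; lia.
have /contentsP[r rR cr] : content x \in contents R.
  by rewrite cRD; apply/contentsP; exists x.
have [up right] := end_dir j x r (conj xT xm) xmax rR cr.
rewrite -cr; have [uD|uD] := boolP (box_up x \in D).
  have rD : box_right x \notin D by move: out; rewrite uD orbF.
  by rewrite (@ribbon_dirE R true) // right.
by rewrite (@ribbon_dirE R false) // up.
Qed.

End CuttingStrip.

Theorem theorem2p8 (A : comPzRingType) (f : nat -> nat -> A) (M : nat)
    (lam mu : seq nat) (n : nat) (Theta : 'I_n -> {fset box})
    (R : {fset box}) (k : {ffun skew_diagram lam mu -> nat}) :
  (0 < M)%N ->
  is_partition lam -> is_partition mu -> subpartition mu lam ->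
  edge_connected (skew_diagram lam mu) ->
  outside_decomposition (skew_diagram lam mu) Theta ->
  is_cutting_strip (skew_diagram lam mu) Theta R ->
  young_tableau k -> diag_constant k ->
  schur_sum f M k
  = \det (\matrix_(i < n, j < n) strip_entry f M k Theta R i j).
Proof.
case: M => // M _ lamP muP mulam _ ThetaD stripR _ kD.
have cvxD : order_convex (skew_diagram lam mu).
  by apply: skew_diagram_convex; exists lam, mu.
set D := skew_diagram lam mu in k cvxD ThetaD stripR kD *.
(* One below the minimum, so that the first content has level 1. *)
pose c0 := min_content D - 1.
have c0D x : x \in D -> c0 < content x.
  move=> xD; have [_ /(_ x xD)] := min_contentP (introT (fset0Pn D) (ex_intro _ x xD)).
  by rewrite /c0; lia.
have [ribT _ dis _ _] := ThetaD; have [RR cRD _ _] := stripR.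
have c0R x : x \in R -> c0 < content x.
  move=> xR; have /contentsP[y yD <-] : content x \in contents D.
    by rewrite -cRD; apply/contentsP; exists x.
  exact: c0D.
have minT j := (min_contentP (ribT j).2).
have maxT j := (max_contentP (ribT j).2).
have [s sP] : exists s : 'I_n -> box,
    forall j, s j \in Theta j /\ content (s j) = min_content (Theta j).
  have ex j : exists x, (x \in Theta j) && (content x == min_content (Theta j)).
    by have [[x xT xm] _] := minT j; exists x; rewrite xT xm /=.
  exists (fun j => xchoose (ex j)) => j.
  by have /andP[? /eqP] := xchooseP (ex j).
rewrite (@schur_sum_chains _ f M (diag_value k) (ribbon_dir R) c0 D n Theta
  (fun j => min_content (Theta j)) (fun j => max_content (Theta j)) s k) //.
- congr (\det _); apply/matrixP => i j; rewrite !mxE /strip_entry.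
  have TR l x : x \in Theta l -> content x \in contents R.
    move=> xT; rewrite cRD; apply/contentsP; exists x => //.
    by apply/(mem_outside_decomposition ThetaD); exists l.
  have [[x xT xa] _] := minT i; have [[y yT yb] _] := maxT j.
  have c0x : c0 < content x by have /contentsP[z /c0R] := TR _ _ xT; move=> + <-.
  have c0y : c0 < content y by have /contentsP[z /c0R] := TR _ _ yT; move=> + <-.
  (* The three cases of [strip_entry]: undefined (value 0), nonempty subribbon, empty subribbon
     (value 1). *)
  rewrite -xa -yb; case: lerP => [ab1|ab1]; last first.
    by apply: green_eq0; lia.
  have [ab|ba] := leP (content x) (content y).
    rewrite (@schur_sum_subribbon _ f M (diag_value k) c0) ?(TR _ _ xT) ?(TR _ _ yT) //.
    by move=> z; rewrite ffunE.
  rewrite schur_sum_empty; last first.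
    by apply/fsetP => z; rewrite !inE; apply/negbTE; move: ab1 ba; lia.
  have -> : `|content x - c0|%N = (`|content y - c0|%N).+1 by lia.
  exact: green_succ.
- exact: mem_outside_decomposition.
- move=> i j x xi xj; apply/eqP/negPn/negP => /dis /fdisjointP /(_ x xi).
  by rewrite xj.
- by move=> j x xj; rewrite (minT j).2 ?(maxT j).2.
- by move=> j x y xj yj; apply: (ribbon_content_inj (ribT j).1).
- by move=> j x; apply: (strip_step ThetaD stripR).
- by move=> j x; apply: (strip_end ThetaD stripR).
- by move=> x; apply: diag_valueE.
Qed.
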